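(* Let $p$ be a prime and let $d\ge 1$ and $n\ge 1$ be integers. Suppose $\Sigma$ is a simplicial complex on the vertex set $[p]=\{1,\dots,p\}$ such that (i) $\Sigma$ is invariant under the map $j\mapsto j+1 \bmod p$ on $[p]$, and (iii) the image of every $\mathbb{Z}/p$-equivariant continuous map $\Sigma^{*(n+1)}\to(\mathbb{R}^{d+1})^p$ contains a point of the diagonal $\{(y,\dots,y)\in(\mathbb{R}^{d+1})^p : y\in\mathbb{R}^{d+1}\}$. Then for every continuous map $f\colon\Delta_n\to\mathbb{R}^d$ there are $p$ faces $\sigma_1,\dots,\sigma_p$ of $\Delta_n$ with $f(\sigma_1)\cap\dots\cap f(\sigma_p)\neq\emptyset$ and such that for every vertex $v$ of $\Delta_n$ the set $\{j\in[p]: v\in\sigma_j\}$ is a face of $\Sigma$.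
   Context: $\Delta_n$ is the $n$-simplex with vertices $v_1,\dots,v_{n+1}$. The join $K*L$ of simplicial complexes has as faces disjoint unions of a face of $K$ and a face of $L$; $\Sigma^{*(n+1)}$ is the $(n+1)$-fold join, whose points are formal convex combinations $\lambda_1x_1+\dots+\lambda_{n+1}x_{n+1}$ with $x_i\in\Sigma$. The generator of $\mathbb{Z}/p$ acts on $\Sigma$ simplicially via $j\mapsto j+1\bmod p$ on vertices, on $\Sigma^{*(n+1)}$ diagonally (in each join factor), and on $(\mathbb{R}^{d+1})^p$ by cyclically shifting the $p$ copies of $\mathbb{R}^{d+1}$. The empty set counts as a face of $\Sigma$. *)

(* Defs.v *)
From mathcomp Require Import all_boot all_order all_algebra.
From mathcomp Require Import all_classical all_reals all_analysis.

Set Implicit Arguments.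
Unset Strict Implicit.
Unset Printing Implicit Defensive.

Import Order.TTheory GRing.Theory Num.Theory.
Import numFieldNormedType.Exports.
Local Open Scope classical_set_scope.
Local Open Scope ring_scope.

(* A simplicial complex is given by its set of faces, the empty one included.
   Singletons need not be faces. *)
Definition simplicial_complex (V : finType) (K : {set {set V}}) : Prop :=
  (finset.set0 \in K) /\
  (forall A B : {set V}, A \subset B -> B \in K -> A \in K).

(* The m-fold join has the disjoint union of m copies of V as vertex set. *)
Definition join_power (V : finType) (m : nat) (K : {set {set V}}) :
    {set {set 'I_m * V}} :=
  [set A : {set 'I_m * V} |
    [forall i : 'I_m, [set v : V | (i, v) \in A]%SET \in K]]%SET.

(* x is the family of barycentric coordinates of a point of |K|. *)
Definition in_realization (R : realType) (V : finType) (K : {set {set V}})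
    (x : V -> R) : Prop :=
  [/\ forall v, 0 <= x v, \sum_v x v = 1 & [set v | x v != 0]%SET \in K].

(* The closed face of the n-simplex spanned by the vertices in s; it is empty
   when s is. *)
Definition face_points (R : realType) (n : nat) (s : {set 'I_n.+1}) :
    set 'rV[R]_n.+1 :=
  [set t : 'rV[R]_n.+1 | in_realization (powerset s) (t ord0)].
Arguments face_points R {n} s.

Definition simplex_points (R : realType) (n : nat) : set 'rV[R]_n.+1 :=
  face_points R [set: 'I_n.+1]%SET.
Arguments simplex_points R n : clear implicits.

(* The formal convex combination of x_1, ..., x_m in |K| with weights l_1, ...,
   l_m is the matrix whose i-th row is l_i x_i. *)
Definition join_points (R : realType) (m p : nat) (K : {set {set 'I_p}}) :
    set 'M[R]_(m, p) :=
  [set x : 'M[R]_(m, p) |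
    in_realization (join_power m K) (fun ij => x ij.1 ij.2)].
Arguments join_points R m {p} K.

(* The generator sends the vertex j to j + 1, so the (j + 1)-st coordinate of
   the image of x is the j-th coordinate of x, in every join factor. *)
Definition shift_join (R : realType) (m p : nat) (x : 'M[R]_(m, p)) :
    'M[R]_(m, p) := colsub (@ord_pred p) x.

(* A point (y_1, ..., y_p) of (R^k)^p is the matrix with rows y_1, ..., y_p;
   it is sent to (y_p, y_1, ..., y_(p-1)). *)
Definition shift_copies (R : realType) (p k : nat) (y : 'M[R]_(p, k)) :
    'M[R]_(p, k) := rowsub (@ord_pred p) y.

Definition diagonal_points (R : realType) (p k : nat) : set 'M[R]_(p, k) :=
  [set Y : 'M[R]_(p, k) | exists y : 'rV[R]_k, forall j, row j Y = y].
Arguments diagonal_points R p k : clear implicits.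

(* Main.v *)
Require Import Defs.
From mathcomp Require Import all_boot all_order all_algebra.
From mathcomp Require Import all_classical all_reals all_analysis.

Set Implicit Arguments.
Unset Strict Implicit.
Unset Printing Implicit Defensive.

Import Order.TTheory GRing.Theory Num.Theory.
Import numFieldNormedType.Exports.
Local Open Scope classical_set_scope.
Local Open Scope ring_scope.

(* A point x of the join has p column sums s_1, ..., s_p, and normalising its
   j-th column gives a point t_j of the simplex whenever s_j > 0.  The map
   sending x to the p vectors (s_j, s_j f(t_j)) is equivariant, and continuous
   also where s_j = 0 because f is bounded.  At a point mapped to the diagonal
   all s_j are equal, hence nonzero, and so all f(t_j) are equal; sigma_j is
   the support of the j-th column. *)

Lemma cvg_matrix (T : Type) (F : set_system T) {FF : Filter F}
    (U : topologicalType) (m n : nat) (g : T -> 'M[U]_(m, n)) (M : 'M[U]_(m, n)) :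
  (forall i j, g u i j @[u --> F] --> M i j) -> g u @[u --> F] --> M.
Proof.
move=> gM A [P MP PA]; rewrite /= in MP.
apply: (@filterS _ F _ [set u | forall i j, P i j (g u i j)]).
  by move=> u; exact: PA.
apply: filter_forall => i; apply: filter_forall => j.
exact: gM (MP i j).
Qed.

(** Since [g u] eventually lies in [A], its convergence to [x] takes place within [A], which is all
    that continuity on [A] asks for. *)
Lemma cvg_comp_within (T : Type) (F : set_system T) {FF : Filter F}
    (U V : topologicalType) (A : set U) (g : T -> U) (f : U -> V) (x : U) :
  A x -> {within A, continuous f} ->
  g u @[u --> F] --> x -> (\forall u \near F, A (g u)) ->
  f (g u) @[u --> F] --> f x.
Proof.
move=> Ax /subspace_continuousP/(_ x Ax) fx gx Ag.
apply: cvg_trans fx => P /= nP.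
have gP : \forall u \near F, A (g u) -> P (f (g u)) by exact: gx nP.
by move: gP Ag; apply: filterS2 => u; apply.
Qed.

Definition weight (R : realType) (n : nat) (w : 'rV[R]_n) : R :=
  \sum_i w ord0 i.

Definition orthant (R : realType) (n : nat) : set 'rV[R]_n :=
  [set w : 'rV[R]_n | forall i, 0 <= w ord0 i].

(* Degree-one homogeneous extension of g from the simplex; where the weight is
   zero the junk value of the inverse is multiplied by zero. *)
Definition cone (R : realType) (n : nat) (g : 'rV[R]_n -> R) (w : 'rV[R]_n) : R :=
  weight w * g ((weight w)^-1 *: w).

Lemma weight_continuous (R : realType) (n : nat) :
  continuous (@weight R n).
Proof.
move=> w.
apply: (@cvg_big _ _ _ _ _ (@add_continuous R^o) _ (nbhs w)) => i _.
exact: coord_continuous.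
Qed.

Lemma weight_ge0 (R : realType) (n : nat) (w : 'rV[R]_n) :
  orthant w -> 0 <= weight w.
Proof. by move=> w0; apply: sumr_ge0 => i _; exact: w0. Qed.

Lemma simplex_pointsP (R : realType) (n : nat) (t : 'rV[R]_n.+1) :
  simplex_points R n t <-> orthant t /\ weight t = 1.
Proof.
split=> [[t0 t1 _]|[t0 t1]]; first by split.
by split=> //; rewrite powersetE finset.subsetT.
Qed.

(** Nonnegative coordinates with sum 1 are at most 1, so the simplex is a closed subset of a cube.
    Compactness serves to bound continuous functions on it. *)
Lemma simplex_compact (R : realType) (n : nat) : compact (simplex_points R n).
Proof.
have -> : simplex_points R n =
    [set v : 'rV[R]_n.+1 | forall i, `[0, 1]%classic (v ord0 i)] `&`
    (@weight R n.+1 @^-1` [set 1]).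
  apply/seteqP; split=> [t /simplex_pointsP[t0 t1]|t [/= t01 t1]].
    split=> // i /=; rewrite in_itv /= t0 /= -t1 /weight (bigD1 i) //= lerDl.
    by apply: sumr_ge0 => j _; exact: t0.
  apply/simplex_pointsP; split=> // i.
  by have := t01 i; rewrite in_itv /= => /andP[].
apply: compact_closedI.
  apply: (@rV_compact R n.+1 (fun=> `[0 : R, 1 : R]%classic)) => i.
  exact: segment_compact.
apply: preimage_closed; last exact: closed_eq.
by move=> w _; exact: weight_continuous.
Qed.

Lemma normalize_simplex (R : realType) (n : nat) (w : 'rV[R]_n.+1) :
  orthant w -> weight w != 0 -> simplex_points R n ((weight w)^-1 *: w).
Proof.
move=> w0 ww; apply/simplex_pointsP; split=> [i|].
  by rewrite mxE mulr_ge0 ?invr_ge0 ?weight_ge0.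
rewrite /weight (eq_bigr (fun i => (weight w)^-1 * w ord0 i)).
  by rewrite -mulr_sumr mulVf.
by move=> i _; rewrite mxE.
Qed.

(** Where the weight is nonzero, normalisation is continuous. Where it vanishes, a bound [M] for [g]
    on the simplex squeezes [cone g u] between [- (weight u * M)] and [weight u * M], both tending
    to 0. *)
Lemma cone_continuous (R : realType) (n : nat) (g : 'rV[R]_n.+1 -> R) :
  {within simplex_points R n, continuous g} ->
  {within @orthant R n.+1, continuous (cone g)}.
Proof.
move=> gc; apply/subspace_continuousP => w w0.
have sc : weight u @[u --> within (@orthant R n.+1) (nbhs w)] --> weight w.
  exact: cvg_within_filter (@weight_continuous R n.+1 w).
have inO : \forall u \near within (@orthant R n.+1) (nbhs w), orthant u.
  exact: withinT.
have [ww|ww] := eqVneq (weight w) 0.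
  have /compact_bounded[B [_ gB]] :
      compact (g @` simplex_points R n : set R^o).
    by apply: continuous_compact gc _; exact: simplex_compact.
  (* [compact_bounded] only makes the numbers strictly above [B] bounds. *)
  pose M := B + 1.
  have gM t : simplex_points R n t -> `|g t| <= M.
    by move=> ts; apply: gB; [rewrite ltrDl | exists t].
  have cone0 : cone g w = 0 by rewrite /cone ww mul0r.
  rewrite [X in _ --> X]cone0.
  apply: (@squeeze_cvgr _ _ _ _ (fun u => - (weight u * M))
    (fun u => weight u * M)).
  - near=> u; rewrite -ler_norml /from_subspace /cone.
    have u0 : orthant u by near: u.
    (* A nearby [u] of weight zero has no normalisation in the simplex, so [gM] does not apply to
       it; but there the cone is 0. *)
    have [->|uw] := eqVneq (weight u) 0; first by rewrite !mul0r normr0.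
    rewrite normrM ger0_norm ?weight_ge0// ler_wpM2l ?weight_ge0//.
    by apply: gM; exact: normalize_simplex.
  - rewrite -[0](@oppr0 R) -[0](@mul0r R M) -ww.
    by apply: cvgN; apply: cvgM => //; exact: cvg_cst.
  - rewrite -[0](@mul0r R M) -ww.
    by apply: cvgM => //; exact: cvg_cst.
apply: cvgM => //; apply: (@cvg_comp_within _ _ _ _ _ (simplex_points R n)) => //.
- exact: normalize_simplex.
- apply: cvgZ; first exact: cvgV.
  exact: cvg_within.
- near=> u; apply: normalize_simplex; first by near: u.
  by near: u; exact: cvgr_neq0 sc ww.
Unshelve. all: by end_near. Qed.

Theorem theorem4p3 (R : realType) (p d n : nat) (Sigma : {set {set 'I_p}})
    (p_prime : prime p) (d_ge1 : (1 <= d)%N) (n_ge1 : (1 <= n)%N)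
    (Sigma_complex : simplicial_complex Sigma)
    (Sigma_invariant : forall A : {set 'I_p},
      A \in Sigma -> [set ordS j | j in A]%SET \in Sigma)
    (Sigma_diagonal : forall F : 'M[R]_(n.+1, p) -> 'M[R]_(p, d.+1),
      {within join_points R n.+1 Sigma, continuous F} ->
      (forall x : 'M[R]_(n.+1, p), join_points R n.+1 Sigma x ->
        F (shift_join x) = shift_copies (F x)) ->
      (F @` join_points R n.+1 Sigma) `&` diagonal_points R p d.+1 !=set0)
    (f : 'rV[R]_n.+1 -> 'rV[R]_d)
    (f_continuous : {within simplex_points R n, continuous f}) :
  exists sigma : 'I_p -> {set 'I_n.+1},
    \bigcap_(j in [set: 'I_p]) (f @` face_points R (sigma j)) !=set0 /\
    forall v : 'I_n.+1, [set j | v \in sigma j]%SET \in Sigma.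
Proof.
pose column (j : 'I_p) (x : 'M[R]_(n.+1, p)) : 'rV[R]_n.+1 := \row_i x i j.
(* The coordinates of (1, f). *)
pose g (k : 'I_d.+1) (t : 'rV[R]_n.+1) : R :=
  oapp (f t ord0) 1 (unlift ord0 k).
pose F (x : 'M[R]_(n.+1, p)) : 'M[R]_(p, d.+1) :=
  \matrix_(j, k) cone (g k) (column j x).
have column_ge0 x j : join_points R n.+1 Sigma x -> orthant (column j x).
  by move=> [x0 _ _] i; rewrite mxE; exact: (x0 (i, j)).
have gc k : {within simplex_points R n, continuous (g k)}.
  apply/subspace_continuousP => t t_simplex; rewrite /g.
  case: unliftP => [k' _|_] /=; last exact: cvg_cst.
  move/subspace_continuousP/(_ t t_simplex) : f_continuous => fc.
  exact: cvg_comp fc (@coord_continuous R 1 d ord0 k' (f t)).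
have column_continuous j : continuous (column j).
  move=> x; apply: (@cvg_matrix _ (nbhs x)) => i i'; rewrite mxE.
  under eq_fun do rewrite mxE.
  exact: coord_continuous.
have Fc : {within join_points R n.+1 Sigma, continuous F}.
  apply/subspace_continuousP => x xJ; apply: cvg_matrix => j k.
  rewrite mxE; under eq_fun do rewrite mxE.
  apply: (@cvg_comp_within _ _ _ _ _ (@orthant R n.+1)).
  - exact: column_ge0.
  - exact: cone_continuous.
  - apply: cvg_within_filter; exact: column_continuous.
  - near=> y; apply: column_ge0; near: y; exact: withinT.
(* [F] treats every column by the same rule, so permuting the columns of [x] permutes the rows of
   [F x] alike. *)
have Fshift x : F (shift_join x) = shift_copies (F x).
  apply/matrixP => j k; rewrite !mxE; congr cone.
  by apply/rowP => i; rewrite !mxE.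
have [Y [[x xJ <-{Y}] [y Fxy]]] := Sigma_diagonal F Fc (fun x _ => Fshift x).
have Fxk j k : cone (g k) (column j x) = y ord0 k.
  by rewrite -(Fxy j) !mxE.
have [x0 x1 xS] := xJ.
(* Coordinate 0 of [g] is the constant 1, whose cone is the weight. *)
have weightE j : weight (column j x) = y ord0 ord0.
  by rewrite -(Fxk j) /cone /g unlift_none mulr1.
have y_neq0 : y ord0 ord0 != 0.
  (* Otherwise all column sums vanish, although the entries of [x] add up to 1. *)
  apply/eqP => y0.
  have := oner_neq0 R; rewrite -x1 -(pair_bigA _ (fun i j => x i j)) /=.
  rewrite exchange_big /= big1 ?eqxx// => j _; apply: etrans y0.
  by rewrite -(weightE j); apply: eq_bigr => i _; rewrite mxE.
pose t j := (weight (column j x))^-1 *: column j x.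
(* Dividing the other coordinates by the common weight leaves a value independent of [j]. *)
have ft j k : f (t j) ord0 k = (y ord0 ord0)^-1 * y ord0 (lift ord0 k).
  by rewrite -(Fxk j (lift ord0 k)) /cone /g liftK /= /t weightE mulKf.
exists (fun j => [set i | x i j != 0]%SET); split.
  exists (\row_k ((y ord0 ord0)^-1 * y ord0 (lift ord0 k))) => j _.
  exists (t j); last by apply/rowP => k; rewrite ft mxE.
  have /normalize_simplex[] := column_ge0 _ j xJ; first by rewrite weightE.
  (* Rescaling a column creates no new nonzero entries. *)
  move=> t0 t1 _; split=> //; rewrite powersetE; apply/fintype.subsetP => i.
  by rewrite !inE !mxE mulf_eq0 => /norP[].
(* The indices [j] with [i] in [sigma j] form the [i]-th slice of the support of [x], a face of
   [Sigma] by definition of the join. *)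
move=> i; move: xS; rewrite inE => /forallP/(_ i).
rewrite (_ : [set j | i \in _]%SET =
  [set j | (i, j) \in [set ij | x ij.1 ij.2 != 0]]%SET) //.
by apply/finset.setP => j; rewrite !inE.
Unshelve. all: by end_near. Qed.
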